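(* There exists a (transverse taut) veering triangulation $\mathcal{V}$ (of some compact, oriented, connected 3-manifold $M$ with nonempty toroidal boundary) for which the lower veering polynomial $V^L_{\mathcal{V}}$ and the upper veering polynomial $V^U_{\mathcal{V}}$ are not equal up to a unit in $\mathbb{Z}[H]$, where $H=H_1(M;\mathbb{Z})/\text{torsion}$.
   Context: $M$ is a compact, oriented, connected 3-manifold with a finite positive number of toroidal boundary components (viewed as cusps), with an ideal triangulation $\mathcal{T}=(T,F,E)$: $T,F,E$ are the sets of ideal tetrahedra, triangles and edges, $|T|=|E|=n$. Transverse taut: a coorientation $\alpha$ is given on every triangle such that for each tetrahedron $t$ two faces (the top faces) are cooriented out of $t$ and two (the bottom faces) into $t$; $t$ is immediately below its top faces and immediately above its bottom faces. The top (bottom) diagonal of $t$ is the common edge of its two top (bottom) faces; the other four edges are equatorial. Assign angle $\pi$ to the two diagonals and $0$ to the equatorial edges; it is required that for each $e\in E$ the angles over all embeddings of $e$ into tetrahedra sum to $2\pi$. So each $e$ is the top diagonal of exactly one tetrahedron (the one immediately below $e$) and the bottom diagonal of exactly one. Veering: a transverse taut triangulation with a colouring $\nu$ of the edges red/blue such that in each tetrahedron, viewed from above (coorientation towards the viewer, using the orientation of $M$) and drawn as a quadrilateral with vertical top diagonal and horizontal bottom diagonal, the equatorial edges of positive slope are red and those of negative slope are blue. Write $\mathcal{V}=(\mathcal{T},\alpha,\nu)$. Let $M^{ab}\to M$ be the maximal free abelian cover (deck group $H$, written multiplicatively), and $\mathcal{V}^{ab}$ the lifted veering triangulation. Fix a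 connected fundamental domain whose closure is triangulated by one lift $1\cdot t$ of each $t\in T$; other tetrahedra are $h\cdot t$, $h\in H$. An edge $h\cdot e$ of $\mathcal{V}^{ab}$ is the lift of $e$ which is the top diagonal of a tetrahedron with $H$-coefficient $h$. Free abelian groups on the tetrahedra/edges of $\mathcal{V}^{ab}$ are identified with $\mathbb{Z}[H]^T$, $\mathbb{Z}[H]^E$. Define $\mathbb{Z}[H]$-homomorphisms $N^L,N^U:\mathbb{Z}[H]^T\to\mathbb{Z}[H]^E$ as follows. If a tetrahedron $1\cdot t$ of $\mathcal{V}^{ab}$ has top diagonal $d_t$ and bottom diagonal $d_b$, then $N^L(1\cdot t)=d_t-d_b-s_1-s_2$, where $s_1,s_2$ are the two equatorial edges of $1\cdot t$ of a colour different from $d_b$; and $N^U(1\cdot t)=d_b-d_t-w_1-w_2$, where $w_1,w_2$ are the two equatorial edges of $1\cdot t$ of a colour different from $d_t$. The lower (upper) veering polynomial $V^L_{\mathcal{V}}$ ($V^U_{\mathcal{V}}$) is the determinant of $N^L$ ($N^U$), i.e. the zeroth Fitting invariant of its cokernel, here considered up to multiplication by a unit of $\mathbb{Z}[H]$. *)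

(* Defs.v *)
From HB Require Import structures.
From mathcomp Require Import all_boot all_order all_algebra perm.
From mathcomp Require Import finmap boolp.
From mathcomp.multinomials Require Import monalg.

Set Implicit Arguments.
Unset Strict Implicit.
Unset Printing Implicit Defensive.

Import GRing.Theory.

Local Open Scope ring_scope.

(** * Oriented ideal triangulations

  The vertices of each of the [n] tetrahedra are numbered by ['I_4], and the
  face [i] of a tetrahedron is the one opposite its vertex [i].  The face [i]
  of [t] is glued to a face of [adj t i] by the affine map that sends the vertex
  [v != i] of [t] to the vertex [glue t i v]; the image [glue t i i] of the
  remaining vertex is the number of the face of [adj t i] glued to it.

  The numbering of the vertices of each tetrahedron is chosen positively
  oriented (vertex 0 being the origin, the vectors to 1, 2, 3 form a direct
  frame for the orientation of the manifold); this makes every [glue t i] odd.  No edge is then identified with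
  itself by a map reversing it.

  An edge of a tetrahedron [t] is given by an ordered pair of distinct faces:
  [(t, i, j)] is the common edge of the faces [i] and [j] of [t].  [turn] sends
  [(t, i, j)] to the next tetrahedron met when turning around that edge and
  leaving [t] through [j]: there, the first face is the one just crossed.  The
  orbit of [(t, i, j)] under [turn] lists exactly once each embedding into a
  tetrahedron of the edge of the triangulation that [(t, i, j)] represents;
  [(t, j, i)] represents the same edge, turned around in the other
  direction. *)

Section Gluing.
Variables (n : nat) (adj : 'I_n -> 'I_4 -> 'I_n) (glue : 'I_n -> 'I_4 -> 'S_4).

Definition turn_of (x : 'I_n * 'I_4 * 'I_4) : 'I_n * 'I_4 * 'I_4 :=
  let: (t, i, j) := x in (adj t j, glue t j j, glue t j i).

(** The link of an ideal vertex is triangulated by the corners [(t, v)]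
  representing it.  The corner [(t, v)] is a triangle whose sides [(t, v, i)]
  lie in the faces [i != v] of [t], and whose vertices [(t, v, w)] lie on the
  edges from [v] to [w != v]. *)
Definition corner_adj (x y : 'I_n * 'I_4) : bool :=
  [exists i, (i != x.2) && (y == (adj x.1 i, glue x.1 i x.2))].

Definition side_adj (x y : 'I_n * 'I_4 * 'I_4) : bool :=
  let: (t, v, i) := x in y == (adj t i, glue t i v, glue t i i).

Definition link_vertex_adj (x y : 'I_n * 'I_4 * 'I_4) : bool :=
  let: (t, v, w) := x in
  [exists i, [&& i != v, i != w & y == (adj t i, glue t i v, glue t i w)]].

Definition nb_classes (T : finType) (e : rel T) (A : {set T}) : nat :=
  #|[set [set y | connect e x y] | x in A]|.

Definition link_triangles (x : 'I_n * 'I_4) : {set 'I_n * 'I_4} :=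
  [set y | connect corner_adj x y].

Definition link_flags (x : 'I_n * 'I_4) : {set 'I_n * 'I_4 * 'I_4} :=
  [set y | (y.1 \in link_triangles x) && (y.2 != y.1.2)].

Definition link_euler_char (x : 'I_n * 'I_4) : int :=
  (nb_classes link_vertex_adj (link_flags x))%:Z
  - (nb_classes side_adj (link_flags x))%:Z
  + #|link_triangles x|%:Z.

End Gluing.

(** The links are closed, connected and oriented surfaces, so they are tori iff
  their Euler characteristic vanishes.  There is at least one of them
  since [0 < n]. *)
Record triangulation (n : nat) := Triangulation {
  adj : 'I_n -> 'I_4 -> 'I_n;
  glue : 'I_n -> 'I_4 -> 'S_4;
  nonempty : (0 < n)%N;
  adjK : forall t i, adj (adj t i) (glue t i i) = t;
  glueK : forall t i, glue (adj t i) (glue t i i) = (glue t i)^-1%g;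
  no_fold : forall t i, (adj t i, glue t i i) != (t, i);
  oriented : forall t i, odd_perm (glue t i);
  connected_tri : forall s t, connect (fun x y => [exists i, adj x i == y]) s t;
  toroidal : forall x, link_euler_char adj glue x = 0
}.

Definition turn n (T : triangulation n) := turn_of (adj T) (@glue n T).

(** * Transverse taut and veering triangulations *)

(** [top t i] means that the face [i] of [t] is cooriented out of [t].  Angles
  are in units of pi: an edge of a tetrahedron is a diagonal iff its two faces
  are both top or both bottom. *)
Record transverse_taut (n : nat) := TransverseTaut {
  tri :> triangulation n;
  top : 'I_n -> 'I_4 -> bool;
  top_glue : forall t i, top (adj tri t i) (glue tri t i i) = ~~ top t i;
  two_top : forall t, #|[set i | top t i]| = 2%N;
  angle_sum : forall t i j, i != j ->
    (\sum_(x <- orbit (turn tri) (t, i, j))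
       (top x.1.1 x.1.2 == top x.1.1 x.2))%N = 2%N
}.

(** Blue means not red.  In [red_equatorial], the vertices of [t] are listed as
  [p 0], [p 1], [p 2], [p 3] where the top diagonal joins [p 0] to [p 1] and the
  bottom diagonal joins [p 2] to [p 3].  If [p] is even, then, in the picture
  seen from above, one can take these vertices to be respectively the upper, the
  lower, the left and the right one: in the frame where the third axis points to
  the viewer, (0,1,1), (0,-1,1), (-1,0,-1), (1,0,-1) are indeed the vertices of
  a positively oriented tetrahedron.  The common edge of the faces [p 0] and
  [p 2] joins [p 1] to [p 3], hence has positive slope.  If [p] is odd, the
  picture is mirrored. *)
Record veering (n : nat) := Veering {
  taut :> transverse_taut n;
  red : 'I_n * 'I_4 * 'I_4 -> bool;
  red_sym : forall t i j, red (t, i, j) = red (t, j, i);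
  red_turn : forall t i j, i != j -> red (turn taut (t, i, j)) = red (t, i, j);
  red_equatorial : forall t (p : 'S_4),
    ~~ top taut t (p 0) -> ~~ top taut t (p 1) ->
    top taut t (p 2) -> top taut t (p 3) ->
    red (t, p 0, p 2) = ~~ odd_perm p
}.

(** * The group H = H_1(M; Z) / torsion

  M deformation retracts onto the 2-complex dual to the triangulation, with a
  vertex for each tetrahedron, an edge for each triangle and a 2-cell for each
  edge.  A 1-chain is a matrix [z] where [z t i] is the coefficient of the dual
  edge leaving [t] through its face [i]. *)

Section Homology.
Variables (n : nat) (T : triangulation n).

Definition is_cycle : {pred 'M[int]_(n, 4)} := fun z =>
  [forall t, forall i, z (adj T t i) (glue T t i i) == - z t i]
  && [forall t, \sum_i z t i == 0].

Lemma is_cycle_zmod : zmod_closed is_cycle.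
Proof.
split=> [|x y /andP[/forallP xa /forallP xs] /andP[/forallP ya /forallP ys]].
  apply/andP; split; apply/forallP=> t; last by rewrite big1 // => i; rewrite mxE.
  by apply/forallP=> i; rewrite !mxE oppr0.
apply/andP; split; apply/forallP=> t.
  apply/forallP=> i; have /forallP/(_ i)/eqP ex := xa t.
  by have /forallP/(_ i)/eqP ey := ya t; rewrite !mxE ex ey opprD.
have /eqP ex := xs t; have /eqP ey := ys t.
under eq_bigr do rewrite !mxE.
by rewrite sumrB ex ey subrr.
Qed.

HB.instance Definition _ := GRing.isZmodClosed.Build _ is_cycle is_cycle_zmod.

Record cycle1 := Cycle1 { cycle_val :> 'M[int]_(n, 4); _ : is_cycle cycle_val }.

HB.instance Definition _ := [isSub for cycle_val].
HB.instance Definition _ := [Choice of cycle1 by <:].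
HB.instance Definition _ := [SubChoice_isSubZmodule of cycle1 by <:].

(** The loop around the edge [x], which leaves the successive tetrahedra
  through the last faces of the elements of the orbit, and enters them through
  the first ones. *)
Definition boundary2 (x : 'I_n * 'I_4 * 'I_4) : 'M[int]_(n, 4) :=
  \matrix_(t, i) (\sum_(y <- orbit (turn T) x)
    (((y.1.1, y.2) == (t, i))%:Z - (y.1 == (t, i))%:Z)).

Definition is_boundary (z : 'M[int]_(n, 4)) : Prop :=
  exists k : 'I_n * 'I_4 * 'I_4 -> int,
    z = \sum_(x | x.1.2 != x.2) k x *: boundary2 x.

Definition torsion_cycle : {pred cycle1} := fun z =>
  `[< exists2 m : int, m != 0 & is_boundary (m *: cycle_val z) >].

Lemma torsion_cycle_zmod : zmod_closed torsion_cycle.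
Proof.
split=> [|x y /asboolP[a a0 [f fE]] /asboolP[b b0 [g gE]]]; apply/asboolP.
  exists 1 => //; exists (fun=> 0).
  by rewrite scaler0 big1 // => x _; rewrite scale0r.
exists (a * b); first by rewrite mulf_neq0.
exists (fun e => b * f e - a * g e).
rewrite [cycle_val _](raddfB (\val : cycle1 -> _)) scalerBr.
rewrite {1}[a * b]mulrC -!scalerA fE gE !scaler_sumr -sumrB.
by apply: eq_bigr => e _; rewrite !scalerA scalerBl.
Qed.

HB.instance Definition _ :=
  GRing.isZmodClosed.Build cycle1 torsion_cycle torsion_cycle_zmod.

Definition H1 : Type := Quotient.quot torsion_cycle.
HB.instance Definition _ := GRing.Zmodule.on H1.

Definition homology_class (z : cycle1) : H1 := \pi_(Quotient.quot torsion_cycle)%qT z.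

End Homology.

(** * The group ring Z[H]

  Finitely supported functions from [H] (written additively) to the integers;
  [<< h >>] is the group element [h]. *)

Definition group_ring (H : zmodType) : Type := {malg int[H]}.

Section GroupRing.
Variable H : zmodType.
Implicit Types (f g : {malg int[H]}).

HB.instance Definition _ := GRing.Zmodule.on (group_ring H).

Definition gr_mul (f g : group_ring H) : group_ring H :=
  \sum_(x <- msupp f) \sum_(y <- msupp g) << f@_x * g@_y *g x + y >>.

Let gr_mulEw (A B : {fset H}) f g :
  (msupp f `<=` A)%fset -> (msupp g `<=` B)%fset ->
  gr_mul f g =
    (\sum_(x <- A) \sum_(y <- B) << f@_x * g@_y *g x + y >> : {malg int[H]}).
Proof.
move=> fA gB; rewrite /gr_mul (big_fset_incl _ fA) /=; last first.
  move=> x _ xf; rewrite big1 // => y _.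
  by rewrite (mcoeff_outdom xf) mul0r monalgU0.
apply: eq_bigr => x _; rewrite (big_fset_incl _ gB) //= => y _ yg.
by rewrite (mcoeff_outdom yg) mulr0 monalgU0.
Qed.

Let gr_mulDl : left_distributive gr_mul +%R.
Proof.
move=> f g h; pose A := (msupp f `|` msupp g)%fset.
rewrite (@gr_mulEw A (msupp h)) ?msuppD_le ?fsubset_refl //.
rewrite (@gr_mulEw A (msupp h) f) ?fsubsetUl ?fsubset_refl //.
rewrite (@gr_mulEw A (msupp h) g) ?fsubsetUr ?fsubset_refl //.
rewrite -big_split; apply: eq_bigr => x _ /=.
rewrite -big_split; apply: eq_bigr => y _ /=.
by rewrite mcoeffD mulrDl monalgUD.
Qed.

Let gr_mulC : commutative gr_mul.
Proof.
move=> f g; rewrite /gr_mul exchange_big /=; apply: eq_bigr => x _.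
by apply: eq_bigr => y _; rewrite mulrC [x + y]addrC.
Qed.

Let gr_mulDr : right_distributive gr_mul +%R.
Proof. by move=> f g h; rewrite gr_mulC gr_mulDl !(gr_mulC f). Qed.

Let gr_mul0l : left_zero 0 gr_mul.
Proof. by move=> f; rewrite /gr_mul msupp0 big_seq_fset0. Qed.

Let gr_mul0r : right_zero 0 gr_mul.
Proof. by move=> f; rewrite gr_mulC gr_mul0l. Qed.

Let gr_mulUU a b x y :
  gr_mul << a *g x >> << b *g y >> = << a * b *g x + y >>.
Proof.
rewrite (@gr_mulEw [fset x]%fset [fset y]%fset) ?msuppU_le //.
by rewrite !big_seq_fset1 !mcoeffUU.
Qed.

Let gr_mul_suml I (r : seq I) (F : I -> group_ring H) g :
  gr_mul (\sum_(i <- r) F i) g = \sum_(i <- r) gr_mul (F i) g.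
Proof.
by elim: r => [|i r IH]; rewrite ?big_nil ?gr_mul0l // !big_cons gr_mulDl IH.
Qed.

Let gr_mul_sumr I (r : seq I) (F : I -> group_ring H) g :
  gr_mul g (\sum_(i <- r) F i) = \sum_(i <- r) gr_mul g (F i).
Proof. by rewrite gr_mulC gr_mul_suml; apply: eq_bigr => i _; rewrite gr_mulC. Qed.

Let gr_mulA : associative gr_mul.
Proof.
have sumE (f : {malg int[H]}) :
    exists (r : seq H) (a : H -> int), f = \sum_(x <- r) << a x *g x >>.
  by exists (msupp f), (fun k => f@_k); exact: monalgE.
move=> f g h; case: (sumE f) (sumE g) (sumE h) => [r [a ->]] [s [b ->]] [u [c ->]].
rewrite !(gr_mul_suml r); apply: eq_bigr => x _.
rewrite (gr_mul_suml s) !(gr_mul_sumr s) (gr_mul_suml s); apply: eq_bigr => y _.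
rewrite !(gr_mul_sumr u); apply: eq_bigr => z _.
by rewrite !gr_mulUU mulrA addrA.
Qed.

Let gr_mul1 : left_id (<< 0 >> : group_ring H) gr_mul.
Proof.
move=> f; rewrite [f in LHS]monalgE gr_mul_sumr [RHS]monalgE.
by apply: eq_bigr => x _; rewrite gr_mulUU mul1r add0r.
Qed.

Let gr_1_neq0 : (<< 0 >> : group_ring H) != 0.
Proof. by rewrite monalgU_eq0. Qed.

HB.instance Definition _ := GRing.Zmodule_isComNzRing.Build (group_ring H)
  gr_mulA gr_mulC gr_mul1 gr_mulDl gr_1_neq0.

Definition gr_elt (h : H) : group_ring H := << h >>.

End GroupRing.

Definition eq_up_to_unit (R : comNzRingType) (x y : R) : Prop :=
  exists u v : R, u * v = 1 /\ x = u * y.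

(** * The veering polynomials *)

(** A connected fundamental domain for the maximal free abelian cover.  The
  tetrahedra of the cover are the [h . t], and the face [i] of [h . t] is glued
  to a face of [(h + shift t i) . adj T t i].  The deck group is identified with
  [H1 T] by [shift_cycle]: the lift of a loop from [h . t] ends at
  [(h + class of the loop) . t]; the sum is over the triangles, each being the
  top face of a unique tetrahedron.  The domain is connected when any two
  tetrahedra of coefficient 0 are joined inside it. *)
Record fundamental_domain n (T : transverse_taut n) := FundamentalDomain {
  shift : 'I_n -> 'I_4 -> H1 T;
  shift_glue : forall t i, shift (adj T t i) (glue T t i i) = - shift t i;
  shift_cycle : forall z : cycle1 T,
    \sum_t \sum_(i | top T t i) shift t i *~ z t i = homology_class z;
  shift_connected : forall s t,
    connect (fun x y => [exists i, (adj T x i == y) && (shift x i == 0)]) s t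
}.

Section VeeringPolynomials.
Variables (n : nat) (V : veering n) (D : fundamental_domain V).

Definition is_top_diagonal (x : 'I_n * 'I_4 * 'I_4) : bool :=
  top V x.1.1 x.1.2 && top V x.1.1 x.2.

(** Every edge of the triangulation is the top diagonal of exactly one
  tetrahedron, the one immediately below it, so the edges are indexed by
  the tetrahedra.  If [x] is an edge of [t], turning around [x] in the cover from
  [1 . t], the tetrahedron of which it is the top diagonal is reached after
  [steps_below x] steps, and is [h . s] with [s = edge_below x] and
  [h = edge_coef x].  So, in the cover, the edge [x] of [1 . t] is
  [h] times the basis vector [s] of Z[H]^E. *)
Definition steps_below (x : 'I_n * 'I_4 * 'I_4) : nat :=
  find is_top_diagonal (orbit (turn V) x).

Definition edge_below (x : 'I_n * 'I_4 * 'I_4) : 'I_n :=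
  (iter (steps_below x) (turn V) x).1.1.

Definition edge_coef (x : 'I_n * 'I_4 * 'I_4) : H1 V :=
  \sum_(k < steps_below x)
    let y := iter k (turn V) x in shift D y.1.1 y.2.

Definition edge_vec (x : 'I_n * 'I_4 * 'I_4) : 'rV[group_ring (H1 V)]_n :=
  \row_s (if s == edge_below x then gr_elt (edge_coef x) else 0).

Definition diagonal (b : bool) (t : 'I_n) : 'I_n * 'I_4 * 'I_4 :=
  let s := enum [pred i | top V t i == b] in (t, nth 0 s 0, nth 0 s 1).

Definition top_diagonal := diagonal true.
Definition bottom_diagonal := diagonal false.

(** The equatorial edges of [t] of a colour different from that of [d]; such
  an edge is common to a unique top face and a unique bottom face. *)
Definition equatorial_other_colour (t : 'I_n) (d : 'I_n * 'I_4 * 'I_4) :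
    'rV[group_ring (H1 V)]_n :=
  \sum_(i | top V t i) \sum_(j | ~~ top V t j && (red V (t, i, j) != red V d))
    edge_vec (t, i, j).

Definition NL (t : 'I_n) : 'rV[group_ring (H1 V)]_n :=
  edge_vec (top_diagonal t) - edge_vec (bottom_diagonal t)
  - equatorial_other_colour t (bottom_diagonal t).

Definition NU (t : 'I_n) : 'rV[group_ring (H1 V)]_n :=
  edge_vec (bottom_diagonal t) - edge_vec (top_diagonal t)
  - equatorial_other_colour t (top_diagonal t).

(** Another fundamental domain, or another ordering of the edges, changes these
  determinants by a unit. *)
Definition lower_veering_polynomial : group_ring (H1 V) :=
  \det (\matrix_(t < n) NL t).

Definition upper_veering_polynomial : group_ring (H1 V) :=
  \det (\matrix_(t < n) NU t).

End VeeringPolynomials.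

(* Main.v *)
From HB Require Import structures.
From mathcomp Require Import all_boot all_order all_algebra perm.
From mathcomp Require Import finmap boolp lra.
From mathcomp.multinomials Require Import monalg.
Require Import Defs.

(** The augmentation Z[H] -> Q, which sends every element of H to 1, is a ring
  morphism; hence two elements that are equal up to a unit have augmentations
  that vanish together.  Applied entry by entry to the matrices of the veering
  polynomials, it forgets in which translate of the fundamental domain an edge
  lies: the augmentation of a veering polynomial is the determinant of an
  integer matrix read off the triangulation alone.

  The theorem is thus a matter of exhibiting a veering triangulation for which
  one of the two determinants vanishes and the other does not.  The one below
  has nine tetrahedra and one cusp.  Its augmented upper matrix is singular, as
  its rows 0, 2, 6 and 8 satisfy [row 0 + row 8 = row 2 + row 6]
  ([upper_augmentation]); its augmented lower matrix has determinant 10 up to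
  sign, and a vector in its left kernel is found to be zero by solving nine
  linear equations ([lower_augmentation]).

  Two things remain.  A fundamental domain must exist: any spanning tree of the
  dual graph gives one, in any transverse taut triangulation, the shift across a
  triangle being the class of the loop that this triangle closes in the tree
  ([exists_fundamental_domain]).  And the nine tetrahedra must satisfy all the
  conditions of a veering triangulation.  These are finite verifications, made
  by computation on natural numbers; only the links of the ideal vertices need
  an argument, as they involve counting equivalence classes.  The single link
  has 36 triangles, 54 sides and 18 vertices, so its Euler characteristic is 0
  ([toroidal9]). *)

Set Implicit Arguments.
Unset Strict Implicit.
Unset Printing Implicit Defensive.

Import GRing.Theory Num.Theory.
Local Open Scope ring_scope.

(** * The augmentation of the veering polynomials *)

Section Augmentation.
Variable H : zmodType.

Definition augmentation (f : group_ring H) : rat :=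
  mmap (intr : int -> rat) (fun=> 1) f.

Lemma augmentation_is_zmod_morphism : zmod_morphism augmentation.
Proof. exact: raddfB. Qed.

HB.instance Definition _ := GRing.isZmodMorphism.Build (group_ring H) rat
  augmentation augmentation_is_zmod_morphism.

Lemma augmentationU a (h : H) : augmentation << a *g h >> = a%:~R.
Proof. by rewrite /augmentation mmapU mulr1. Qed.

Lemma augmentation_elt (h : H) : augmentation (gr_elt h) = 1.
Proof. exact: augmentationU. Qed.

Lemma augmentation_is_monoid_morphism : monoid_morphism augmentation.
Proof.
split=> [|f g]; first exact: augmentation_elt.
rewrite [f * g]/(gr_mul f g) /gr_mul raddf_sum [augmentation f]mmapE mulr_suml.
apply: eq_bigr => x _; rewrite raddf_sum [augmentation g]mmapE mulr_sumr.
by apply: eq_bigr => y _; rewrite /= augmentationU !mulr1 rmorphM.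
Qed.

HB.instance Definition _ := GRing.isMonoidMorphism.Build (group_ring H) rat
  augmentation augmentation_is_monoid_morphism.

Lemma eq_up_to_unit_augmentation (f g : group_ring H) :
  eq_up_to_unit f g -> augmentation g = 0 -> augmentation f = 0.
Proof. by case=> u [v [_ ->]] g0; rewrite rmorphM /= g0 mulr0. Qed.

Lemma augmentation_row_sub n (a b c : 'rV[group_ring H]_n) s :
  augmentation ((a - b - c) 0 s) =
  augmentation (a 0 s) - augmentation (b 0 s) - augmentation (c 0 s).
Proof. by rewrite !mxE !raddfB. Qed.

End Augmentation.

Section Polynomials.
Variables (n : nat) (V : veering n) (D : fundamental_domain V).

Lemma augmentation_edge_vec x s :
  augmentation (edge_vec D x 0 s) = (s == edge_below V x)%:R.
Proof. by rewrite mxE; case: eqP; rewrite ?augmentation_elt ?raddf0. Qed.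

Definition nb_equatorial (t : 'I_n) (d : 'I_n * 'I_4 * 'I_4) (s : 'I_n) : nat :=
  (\sum_(i | top V t i) \sum_(j | ~~ top V t j && (red V (t, i, j) != red V d))
     (s == edge_below V (t, i, j)))%N.

Lemma augmentation_equatorial t d s :
  augmentation (equatorial_other_colour D t d 0 s) = (nb_equatorial t d s)%:R.
Proof.
rewrite summxE raddf_sum natr_sum; apply: eq_bigr => i _.
rewrite summxE raddf_sum natr_sum; apply: eq_bigr => j _.
exact: augmentation_edge_vec.
Qed.

Lemma augmentation_NL t s : augmentation (NL D t 0 s) =
  (s == edge_below V (top_diagonal V t))%:R
  - (s == edge_below V (bottom_diagonal V t))%:R
  - (nb_equatorial t (bottom_diagonal V t) s)%:R.
Proof.
rewrite augmentation_row_sub; congr (_ - _ - _).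
- exact: augmentation_edge_vec.
- exact: augmentation_edge_vec.
exact: augmentation_equatorial.
Qed.

Lemma augmentation_NU t s : augmentation (NU D t 0 s) =
  (s == edge_below V (bottom_diagonal V t))%:R
  - (s == edge_below V (top_diagonal V t))%:R
  - (nb_equatorial t (top_diagonal V t) s)%:R.
Proof.
rewrite augmentation_row_sub; congr (_ - _ - _).
- exact: augmentation_edge_vec.
- exact: augmentation_edge_vec.
exact: augmentation_equatorial.
Qed.

Lemma augmentation_det (N : 'I_n -> 'rV[group_ring (H1 V)]_n) :
  augmentation (\det (\matrix_(t < n) N t)) =
  \det (\matrix_(t, s) augmentation (N t 0 s)).
Proof.
rewrite -det_map_mx; congr (\det _).
by apply/matrixP=> t s; rewrite !mxE.
Qed.

End Polynomials.

(** * Fundamental domains from spanning trees *)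

Section HomologyClass.
Variables (n : nat) (T : triangulation n).

Lemma homology_class_is_zmod_morphism : zmod_morphism (@homology_class n T).
Proof. exact: (pi_is_zmod_morphism (Quotient.quot (@torsion_cycle n T))). Qed.

HB.instance Definition _ := GRing.isZmodMorphism.Build (cycle1 T) (H1 T)
  (@homology_class n T) homology_class_is_zmod_morphism.

End HomologyClass.

Section FundamentalDomain.
Variables (n : nat) (T : transverse_taut n).

(** The other name of the triangle [x]: each triangle is a face of a tetrahedron
  in two ways, once as a top face and once as a bottom face. *)
Definition partner (x : 'I_n * 'I_4) : 'I_n * 'I_4 :=
  (adj T x.1 x.2, glue T x.1 x.2 x.2).

Lemma partnerK : involutive partner.
Proof. by case=> t i; rewrite /partner /= adjK glueK permK. Qed.

Lemma top_partner x : top T (partner x).1 (partner x).2 = ~~ top T x.1 x.2.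
Proof. exact: top_glue. Qed.

(** The 1-chain of the dual edge that leaves [x.1] through its face [x.2]: in a
  1-chain both names of a triangle carry opposite coefficients. *)
Definition dual_edge (x : 'I_n * 'I_4) : 'M[int]_(n, 4) :=
  delta_mx x.1 x.2 - delta_mx (partner x).1 (partner x).2.

Lemma dual_edge_partner x : dual_edge (partner x) = - dual_edge x.
Proof. by rewrite /dual_edge partnerK opprB. Qed.

Lemma dual_edgeE x y :
  dual_edge x y.1 y.2 = (y == x)%:R - (y == partner x)%:R.
Proof. by case: x y => t i [s j]; rewrite !mxE. Qed.

Definition antisymmetric_chain (z : 'M[int]_(n, 4)) :=
  forall x, z (partner x).1 (partner x).2 = - z x.1 x.2.

Lemma antisymmetric_chainD y z : antisymmetric_chain y -> antisymmetric_chain z ->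
  antisymmetric_chain (y + z).
Proof. by move=> ya za x; rewrite mxE ya za -opprD [in RHS]mxE. Qed.

Lemma antisymmetric_chainN z : antisymmetric_chain z -> antisymmetric_chain (- z).
Proof. by move=> za x; rewrite mxE za [in RHS]mxE. Qed.

Lemma dual_edge_antisymmetric x : antisymmetric_chain (dual_edge x).
Proof.
move=> y; rewrite !dual_edgeE opprB.
by rewrite (inj_eq (inv_inj partnerK)) (inv_eq partnerK).
Qed.

(** The boundary of the 1-chain [z] at the vertex [s], up to sign. *)
Definition divergence (z : 'M[int]_(n, 4)) (s : 'I_n) : int := \sum_i z s i.

Lemma divergenceD y z s : divergence (y + z) s = divergence y s + divergence z s.
Proof. by rewrite -big_split; apply: eq_bigr => i _; rewrite mxE. Qed.

Lemma divergenceN z s : divergence (- z) s = - divergence z s.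
Proof. by rewrite -sumrN; apply: eq_bigr => i _; rewrite mxE. Qed.

Lemma divergence_dual_edge x s :
  divergence (dual_edge x) s = (s == x.1)%:R - (s == (partner x).1)%:R.
Proof.
have sum_delta (y : 'I_n * 'I_4) :
    \sum_i (delta_mx y.1 y.2 : 'M[int]_(n, 4)) s i = (s == y.1)%:R.
  rewrite (bigD1 y.2) //= big1 => [|i iN]; first by rewrite mxE eqxx andbT addr0.
  by rewrite mxE (negPf iN) andbF.
by rewrite divergenceD divergenceN /divergence !sum_delta.
Qed.

Lemma is_cycleP z :
  reflect (antisymmetric_chain z /\ forall s, divergence z s = 0) (is_cycle T z).
Proof.
apply: (iffP andP) => [[/forallP a /forallP b]|[a b]].
  split=> [[t i]|s]; last exact/eqP/b.
  by have /forallP/(_ i)/eqP := a t.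
split; apply/forallP=> t; last exact/eqP/b.
by apply/forallP=> i; apply/eqP/(a (t, i)).
Qed.

(** Depth is the distance to [r] in the dual graph; a neighbour of smaller depth
  is the parent in a spanning tree. *)
Lemma exists_depth (r : 'I_n) : exists d : 'I_n -> nat, forall t,
  if d t is k.+1 then exists i, d (adj T t i) = k else t = r.
Proof.
pose e : rel 'I_n := fun x y => [exists i, adj T x i == y].
pose walk t k := `[< exists2 p, path e t p /\ last t p = r & size p = k >].
have walk_ex t : exists k, walk t k.
  have /connectP[p pth lst] := connected_tri T t r.
  by exists (size p); apply/asboolP; exists p.
pose d t := ex_minn (walk_ex t).
have dP t : walk t (d t) by rewrite /d; case: ex_minnP.
have d_le t k : walk t k -> (d t <= k)%N by rewrite /d; case: ex_minnP => m _; apply.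
exists d => t; case dt: (d t) => [|k].
  by have /asboolP[[|x p] [_ lst] sz] := dP t; last by rewrite dt in sz.
have /asboolP[[|x p] [/= pth lst] sz] := dP t; first by rewrite dt in sz.
case/andP: pth => /existsP[i /eqP tx] pth; exists i; rewrite tx.
have {}sz : size p = k by rewrite dt in sz; case: sz.
apply/eqP; rewrite eqn_leq d_le /=; last by apply/asboolP; exists p.
have /asboolP[q [qpth qlst] qsz] := dP x.
rewrite -ltnS -dt -qsz; apply: d_le; apply/asboolP; exists (x :: q) => //=.
by split=> //; rewrite qpth andbT; apply/existsP; exists i; rewrite tx.
Qed.

Fixpoint chain_to_root (up : 'I_n -> 'I_4) (k : nat) (t : 'I_n) : 'M[int]_(n, 4) :=
  if k is k'.+1
  then dual_edge (t, up t) + chain_to_root up k' (adj T t (up t)) else 0.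

(** A spanning tree, encoded by the chains [c t] of its paths from [t] to the
  root [r].  The relation in the last clause is adjacency along an edge of the
  tree: there, the path from [x] starts with the edge from [x] to [y]. *)
Lemma exists_spanning_tree (r : 'I_n) : exists c : 'I_n -> 'M[int]_(n, 4),
  forall t, [/\ antisymmetric_chain (c t),
    forall s, divergence (c t) s = (s == t)%:R - (s == r)%:R &
    connect (fun x y => [exists i,
      (adj T x i == y) && (c x == dual_edge (x, i) + c y)]) t r].
Proof.
have [d dP] := exists_depth r.
have /choice[up upP] t : exists i, (0 < d t)%N -> d (adj T t i) = (d t).-1.
  by have := dP t; case: (d t) => [_|k [i iP]]; [exists 0 | exists i].
exists (fun t => chain_to_root up (d t) t) => t.
have [k] := ubnP (d t); elim: k t => // k IH t /ltnSE dk.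
have := dP t; have := upP t; case dt: (d t) dk => [|m] /= dk.
  move=> _ ->; split=> [x|s|]; last exact: connect0.
    by rewrite !mxE oppr0.
  by rewrite subrr /divergence big1 // => i _; rewrite mxE.
move/(_ isT) => du _; have [|asym div con] := IH (adj T t (up t)).
  by rewrite du.
rewrite du in asym div con; split=> [|s|].
- exact: antisymmetric_chainD (dual_edge_antisymmetric _) asym.
- by rewrite divergenceD div divergence_dual_edge addrA subrK.
apply: connect_trans con; apply/connect1/existsP; exists (up t).
by rewrite eqxx dt du /=.
Qed.

Lemma sum_top_partner (V : zmodType) (F : 'I_n * 'I_4 -> V) :
  \sum_(x | top T x.1 x.2) F (partner x) = \sum_(x | ~~ top T x.1 x.2) F x.
Proof.
rewrite [RHS](reindex_inj (inv_inj partnerK)).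
by apply: eq_bigl => x; rewrite top_partner negbK.
Qed.

(** The shift across a triangle is the class of the loop that it closes with the
  tree: from the root to one side, across the triangle, and back to the root.  It
  vanishes on the tree, whence the connectedness of the domain.  When these
  loops are summed with the coefficients of a cycle [z], the tree paths gather at
  each tetrahedron with the divergence of [z] as coefficient, that is, they
  cancel, and the dual edges that remain sum to [z]. *)
Lemma exists_fundamental_domain : inhabited (fundamental_domain T).
Proof.
pose r := Ordinal (nonempty T).
have [c cP] := exists_spanning_tree r.
pose m x := dual_edge x + c (partner x).1 - c x.1.
have m_cycle x : is_cycle T (m x).
  have [ax dx _] := cP x.1; have [ay dy _] := cP (partner x).1.
  apply/is_cycleP; split=> [|s].
    apply: antisymmetric_chainD; last exact: antisymmetric_chainN.
    exact: antisymmetric_chainD (dual_edge_antisymmetric x) ay.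
  rewrite /m 2!divergenceD divergenceN dx dy divergence_dual_edge.
  by rewrite addrA subrK subrr.
pose loop x := Cycle1 (m_cycle x).
have loop_partner x : loop (partner x) = - loop x.
  apply: val_inj; rewrite [RHS]raddfN /= /m dual_edge_partner partnerK.
  by move: (dual_edge x) => e; rewrite !opprD opprK addrAC.
pose sh t i : H1 T := homology_class (loop (t, i)).
split; exists sh.
- by move=> t i; rewrite /sh -raddfN -(loop_partner (t, i)).
- move=> z; rewrite pair_big_dep /=.
  have /is_cycleP[za zd] : is_cycle T (val z) := valP z.
  have -> : \sum_(x | top T x.1 x.2) sh x.1 x.2 *~ z x.1 x.2 =
      homology_class (\sum_(x | top T x.1 x.2) loop x *~ z x.1 x.2).
    rewrite [RHS]raddf_sum; apply: eq_bigr => -[t i] _ /=.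
    by rewrite raddfMz.
  congr homology_class; apply: val_inj; rewrite [LHS]raddf_sum.
  rewrite (eq_bigr (fun x => m x *~ z x.1 x.2)); last by move=> x _; exact: raddfMz.
  under eq_bigr do rewrite /m mulrzBl mulrzDl.
  rewrite sumrB big_split /=.
  have -> : \sum_(x | top T x.1 x.2) c (partner x).1 *~ z x.1 x.2 =
      - \sum_(x | ~~ top T x.1 x.2) c x.1 *~ z x.1 x.2.
    rewrite -sum_top_partner -sumrN; apply: eq_bigr => x _.
    by rewrite za mulrNz opprK.
  have tot : \sum_(x | top T x.1 x.2) c x.1 *~ z x.1 x.2
      + \sum_(x | ~~ top T x.1 x.2) c x.1 *~ z x.1 x.2 = 0.
    transitivity (\sum_x c x.1 *~ z x.1 x.2).
      by rewrite [RHS](bigID (fun x => top T x.1 x.2)).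
    rewrite -(pair_bigA _ (fun t i => c t *~ z t i)) big1 //= => t _.
    by rewrite -mulrz_sumr -[\sum_i _]/(divergence z t) zd mulr0z.
  rewrite -addrA -opprD [X in - X]addrC tot subr0.
  apply/matrixP=> s j; rewrite summxE.
  under eq_bigr => x _ do rewrite -scaler_int mxE (dual_edgeE x (s, j)) intz.
  under eq_bigr => x _ do rewrite mulrBr.
  rewrite sumrB.
  have -> : \sum_(x | top T x.1 x.2) z x.1 x.2 * ((s, j) == partner x)%:R =
      - \sum_(x | ~~ top T x.1 x.2) z x.1 x.2 * ((s, j) == x)%:R.
    rewrite -sum_top_partner -sumrN; apply: eq_bigr => x _.
    by rewrite za mulNr opprK.
  rewrite opprK; transitivity (\sum_x z x.1 x.2 * ((s, j) == x)%:R).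
    by rewrite [RHS](bigID (fun x => top T x.1 x.2)).
  rewrite (bigD1 (s, j)) //= eqxx mulr1.
  by rewrite big1 ?addr0 // => x xN; rewrite eq_sym (negPf xN) mulr0.
- move=> s t; pose e := fun x y => [exists i, (adj T x i == y) && (sh x i == 0)].
  have e_sym : symmetric e.
    suff sub x y : e x y -> e y x by move=> x y; apply/idP/idP; apply: sub.
    case/existsP=> i /andP[/eqP <- sh0]; apply/existsP.
    exists (glue T x i i); rewrite adjK eqxx /sh /=; apply/eqP.
    transitivity (homology_class (- loop (x, i))).
      exact: congr1 (loop_partner (x, i)).
    by apply/eqP; rewrite raddfN oppr_eq0.
  have to_root x : connect e x r.
    have [_ _] := cP x; apply: connect_sub => a b /existsP[i /andP[/eqP ab /eqP cE]].
    apply/connect1/existsP; exists i; rewrite ab eqxx /= /sh.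
    suff -> : loop (a, i) = 0 by rewrite raddf0.
    by apply: val_inj; rewrite /= /m /= ab cE subrr.
  by apply: connect_trans (to_root s) _; rewrite (sym_connect_sym e_sym).
Qed.
End FundamentalDomain.

(** * Counting classes and computing orbits in finite types *)

(** Equivalence classes are counted by their representatives: [r] selects one in
  each class contained in [A], and those selected are the fixed points of [r]. *)
Lemma nb_classes_retract (T : finType) (e : rel T) (A : {set T}) (r : T -> T) :
    symmetric e ->
    (forall x, x \in A -> connect e x (r x)) ->
    (forall x y, x \in A -> e x y -> (y \in A) && (r y == r x)) ->
  nb_classes e A = #|[set x in A | r x == x]|.
Proof.
move=> /sym_connect_sym e_sym r_conn r_inv.
have inv x y : x \in A -> connect e x y -> y \in A /\ r y = r x.
  move=> xA /connectP[p]; elim: p x xA => [|z p IH] x xA /=; first by move=> _ ->.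
  case/andP=> xz pth ylast; have /andP[zA /eqP <-] := r_inv _ _ xA xz.
  exact: IH.
have class_eq x y : connect e x y -> [set z | connect e x z] = [set z | connect e y z].
  by move=> xy; apply/setP=> z; rewrite !inE (same_connect e_sym xy).
rewrite /nb_classes -[in RHS](@card_in_imset _ _ (fun x => [set y | connect e x y])).
  congr #|pred_of_set _|; apply/setP=> C; apply/imsetP/imsetP => -[x xA ->].
    have xr := r_conn x xA; have [rA rr] := inv _ _ xA xr.
    by exists (r x); rewrite ?inE ?rA ?rr ?eqxx //; apply: class_eq.
  by exists x => //; case/setIdP: xA.
move=> x y /setIdP[xA /eqP rx] /setIdP[yA /eqP ry] /setP/(_ y).
by rewrite !inE connect0 => /(inv _ _ xA)[_]; rewrite rx ry.
Qed.

(** This is how an orbit gets computed: [c] encodes the elements of [T] in a type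
  where [f] can be evaluated, as [g], and [m] is the length found there. *)
Lemma map_orbit (T : finType) (U : eqType) (f : T -> T) (g : U -> U) (c : T -> U)
    (x : T) (m : nat) :
    injective c -> (forall y, c (f y) = g (c y)) ->
    (0 < m)%N -> iter m g (c x) = c x -> uniq (traject g (c x) m) ->
  map c (orbit f x) = traject g (c x) m.
Proof.
move=> c_inj cf m_gt0 gm g_uniq.
have c_iter k y : c (iter k f y) = iter k g (c y).
  by elim: k => //= k IH; rewrite cf IH.
have c_traject k : map c (traject f x k) = traject g (c x) k.
  by elim: k x {gm g_uniq} => //= k IH y; rewrite IH cf.
have f_uniq : uniq (traject f x m) by rewrite -(map_inj_uniq c_inj) c_traject.
have f_cycle : fcycle f (traject f x m).
  case: m m_gt0 gm {g_uniq f_uniq} => // m _ gm.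
  rewrite /= rcons_path fpath_traject /= last_traject -iterS.
  by apply/eqP/c_inj; rewrite c_iter.
rewrite /orbit (order_cycle f_cycle f_uniq) ?size_traject //.
by case: m m_gt0 {gm g_uniq f_uniq f_cycle} => // m _; rewrite /= mem_head.
Qed.

(** * Verifications by computation on tetrahedra, faces and vertices *)

(* Tetrahedra, faces and vertices are encoded by natural numbers, since the
   enumeration of a type of ordinals does not reduce well.  A property that
   holds for a list of codes, by evaluation, is then transferred to the flags
   or corners that they encode. *)

Definition corner := ('I_9 * 'I_4)%type.
(** Used both for an edge [(t, i, j)], given by the two faces that meet there,
  and for a side [(t, v, i)] or a vertex [(t, v, w)] of the corner [(t, v)]. *)
Definition flag := ('I_9 * 'I_4 * 'I_4)%type.
Definition corner_code (x : corner) : nat * nat := (x.1 : nat, x.2 : nat).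
Definition code (x : flag) : nat * nat * nat := (x.1.1 : nat, x.1.2 : nat, x.2 : nat).

Lemma code_inj : injective code.
Proof. by move=> [[t i] j] [[s k] l] [/val_inj -> /val_inj -> /val_inj ->]. Qed.

Lemma corner_code_inj : injective corner_code.
Proof. by move=> [t i] [s k] [/val_inj -> /val_inj ->]. Qed.

Definition corner_codes : seq (nat * nat) :=
  [seq (t, i) | t <- iota 0 9, i <- iota 0 4].
Definition codes : seq (nat * nat * nat) :=
  [seq (x, j) | x <- corner_codes, j <- iota 0 4].

Lemma mem_iota_ord n (k : nat) : reflect (exists i : 'I_n, k = i) (k \in iota 0 n).
Proof.
rewrite mem_iota add0n; apply: (iffP idP) => [kn|[i ->]]; last exact: ltn_ord.
by exists (Ordinal kn).
Qed.

Lemma corner_codesP y : reflect (exists x, y = corner_code x) (y \in corner_codes).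
Proof.
apply: (iffP allpairsP) => [[[t i] []]|[[t i] ->]].
  move=> /(mem_iota_ord 9)[{}t ->] /(mem_iota_ord 4)[{}i ->] ->.
  by exists (t, i).
exists (t : nat, i : nat); split=> //.
  by apply/(mem_iota_ord 9); exists t.
by apply/(mem_iota_ord 4); exists i.
Qed.

Lemma codesP y : reflect (exists x, y = code x) (y \in codes).
Proof.
apply: (iffP allpairsP) => [[[z j] []]|[[[t i] j] ->]].
  move=> /corner_codesP[[t i] ->] /(mem_iota_ord 4)[{}j ->] ->.
  by exists (t, i, j).
exists ((t : nat, i : nat), j : nat); split=> //.
  by apply/corner_codesP; exists (t, i).
by apply/(mem_iota_ord 4); exists j.
Qed.

Lemma forall_corner (P : pred (nat * nat)) :
  all P corner_codes -> forall (t : 'I_9) (i : 'I_4), P (t : nat, i : nat).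
Proof. by move/allP=> cP t i; apply: cP; apply/corner_codesP; exists (t, i). Qed.

Lemma forall_flag (P : pred (nat * nat * nat)) :
  all P codes -> forall x, P (code x).
Proof. by move/allP=> cP x; apply: cP; apply/codesP; exists x. Qed.

Lemma card_flags (P : pred (nat * nat * nat)) :
  #|[set x : flag | P (code x)]| = count P codes.
Proof.
rewrite cardE -(size_map code) -size_filter; apply/perm_size/uniq_perm.
- by rewrite (map_inj_uniq code_inj) enum_uniq.
- by rewrite filter_uniq //; vm_compute.
move=> y; rewrite mem_filter; apply/mapP/andP => [[x]|[Py /codesP[x yE]]].
  by rewrite mem_enum inE => Px ->; split=> //; apply/codesP; exists x.
by exists x => //; rewrite mem_enum inE -yE.
Qed.

(** * The gluing of nine tetrahedra *)

(** The entry [(s, j)] in row [t] and column [i] means that the face [i] of the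
  tetrahedron [t] is glued to the face [j] of [s].  In every tetrahedron, faces
  0 and 1 are the bottom faces, faces 2 and 3 the top faces. *)
Definition pairing : seq (seq (nat * nat)) := [::
  [:: (7,3); (3,3); (3,0); (4,0)];
  [:: (6,2); (8,3); (5,0); (5,1)];
  [:: (8,2); (5,2); (4,1); (3,1)];
  [:: (0,2); (2,3); (7,0); (0,1)];
  [:: (0,3); (2,2); (6,1); (8,0)];
  [:: (1,2); (1,3); (2,1); (7,1)];
  [:: (7,2); (4,2); (1,0); (8,1)];
  [:: (3,2); (5,3); (6,0); (0,0)];
  [:: (4,3); (6,3); (2,0); (1,1)]]%N.

Definition tet_across (t i : nat) : nat := (nth (0, 0) (nth [::] pairing t) i).1.
Definition face_across (t i : nat) : nat := (nth (0, 0) (nth [::] pairing t) i).2.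

Definition is_top (i : nat) : bool := (1 < i)%N.
(** The other face on the same side, top or bottom, of a tetrahedron. *)
Definition twin (i : nat) : nat := nth 0 [:: 1; 0; 3; 2]%N i.

(** The colour of the edge common to faces [i] and [j] of [t].  All tetrahedra
  have the same position with respect to the picture that defines veering, so
  that the equatorial edges of a given name have a fixed colour.  The top
  diagonal is red in tetrahedra 0, 1, 2, the bottom diagonal is red in
  tetrahedra 3, 4, 5, and the other diagonals are blue. *)
Definition red_pair (t i j : nat) : bool :=
  if is_top i && is_top j then (t < 3)%N
  else if is_top i || is_top j then ~~ odd (i + j)
  else (3 <= t < 6)%N.

(** A face has two edges of the colour of its diagonal, [red_pair t i (twin i)],
  and one odd edge of the other colour.  Gluings must match odd edges and reverse
  orientation, so the pairing of the faces and the colours determine them.  The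
  vertex of face [i] opposite to its odd edge has parity different from [i] if
  the diagonal is red, and the same parity if it is blue; the gluing is straight
  when this vertex has the number of the face across. *)
Definition straight (t i : nat) : bool :=
  odd (i + face_across t i) == red_pair t i (twin i).

Definition swap (x y z : nat) : nat :=
  if z == x then y else if z == y then x else z.

(** A gluing of the face [i] to a face [j] exchanges [i] and [j] and fixes the
  two other numbers if it is straight; otherwise it is the 4-cycle
  [i -> j -> twin j -> twin i -> i]. *)
Definition vertex_across (t i v : nat) : nat :=
  let j := face_across t i in
  if straight t i then swap i j v
  else swap i (twin i) (swap i (twin j) (swap i j v)).

Definition adj9 (t : 'I_9) (i : 'I_4) : 'I_9 := inord (tet_across t i).
Definition glue9 (t : 'I_9) (i : 'I_4) : 'S_4 :=
  let j : 'I_4 := inord (face_across t i) in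
  if straight t i then tperm i j
  else (tperm i j * tperm i (inord (twin j)) * tperm i (inord (twin i)))%g.

Lemma val_tperm n (x y z : 'I_n) : tperm x y z = swap x y z :> nat.
Proof. by rewrite permE /= -!val_eqE /swap /=; do 2?case: ifP. Qed.

Lemma adj9E t i : adj9 t i = tet_across t i :> nat.
Proof.
rewrite inordK //.
by apply: (@forall_corner (fun x => (tet_across x.1 x.2 < 9)%N)); vm_compute.
Qed.

Lemma face_across_lt4 (t : 'I_9) (i : 'I_4) : (face_across t i < 4)%N.
Proof.
by apply: (@forall_corner (fun x => (face_across x.1 x.2 < 4)%N)); vm_compute.
Qed.

Lemma twin_lt4 (i : nat) : (twin i < 4)%N.
Proof. by case: i => [|[|[|[|[|i]]]]]. Qed.

Lemma glue9E t i v : glue9 t i v = vertex_across t i v :> nat.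
Proof.
rewrite /glue9 /vertex_across; case: ifP => _; rewrite ?permM !val_tperm;
by rewrite !inordK ?face_across_lt4 ?twin_lt4.
Qed.

Lemma glue9_self t i : glue9 t i i = face_across t i :> nat.
Proof.
rewrite glue9E; apply/eqP.
by apply: (@forall_corner (fun x => vertex_across x.1 x.2 x.2 == face_across x.1 x.2));
  vm_compute.
Qed.

Lemma glue9_odd t i : odd_perm (glue9 t i).
Proof.
rewrite /glue9.
have neq (k : nat) : (k < 4)%N -> (i != inord k) = (i != k :> nat).
  by move=> k4; rewrite -val_eqE /= inordK.
case: ifP => _; rewrite ?odd_permM !odd_tperm !neq ?twin_lt4 ?inordK ?face_across_lt4 //.
  by apply: (@forall_corner (fun x => x.2 != face_across x.1 x.2)); vm_compute.
by apply: (@forall_corner (fun x => let j := face_across x.1 x.2 in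
  (x.2 != j) (+) (x.2 != twin j) (+) (x.2 != twin x.2))); vm_compute.
Qed.

Lemma adj9K t i : adj9 (adj9 t i) (glue9 t i i) = t.
Proof.
apply: val_inj; rewrite /= adj9E adj9E glue9_self; apply/eqP.
by apply: (@forall_corner (fun x =>
  tet_across (tet_across x.1 x.2) (face_across x.1 x.2) == x.1)); vm_compute.
Qed.

Lemma glue9K t i : glue9 (adj9 t i) (glue9 t i i) = (glue9 t i)^-1%g.
Proof.
rewrite -[RHS]mulg1; apply/(canRL (mulKg _))/permP=> v; apply: val_inj.
rewrite perm1 permM /= glue9E adj9E glue9_self glue9E; apply/eqP.
have check : all (fun x => vertex_across (tet_across x.1.1 x.1.2)
    (face_across x.1.1 x.1.2) (vertex_across x.1.1 x.1.2 x.2) == x.2) codes.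
  by vm_compute.
exact: (forall_flag check (t, i, v)).
Qed.

(** The corners met when leaving [x] through the successive faces listed in [w];
  the walk stops at the first number that is not a face at the corner. *)
Fixpoint corner_walk (x : nat * nat) (w : seq nat) : seq (nat * nat) :=
  if w is i :: w' then
    let y := (tet_across x.1 i, vertex_across x.1 i x.2) in
    if (i < 4)%N && (i != x.2) then y :: corner_walk y w' else [::]
  else [::].

Lemma corner_walk_connect w (x y : corner) :
  corner_code y \in corner_walk (corner_code x) w ->
  connect (corner_adj adj9 glue9) x y.
Proof.
elim: w x => // k w IH x /=; case: ifP => // /andP[k4 kx].
pose i := Ordinal k4; pose z : corner := (adj9 x.1 i, glue9 x.1 i x.2).
have xz : connect (corner_adj adj9 glue9) x z.
  by apply/connect1/existsP; exists i; rewrite eqxx andbT -val_eqE.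
have zE : corner_code z = (tet_across x.1 k, vertex_across x.1 k x.2).
  by rewrite /corner_code /= adj9E glue9E.
rewrite -zE inE => /orP[/eqP/corner_code_inj -> //|].
by move/IH; apply: connect_trans.
Qed.

Lemma corner_adj_sym : symmetric (corner_adj adj9 glue9).
Proof.
suff sub x y : corner_adj adj9 glue9 x y -> corner_adj adj9 glue9 y x.
  by move=> x y; apply/idP/idP; apply: sub.
case: x y => t v [s w] /existsP[i /andP[/= iv /eqP[-> ->]]]; apply/existsP.
exists (glue9 t i i); rewrite (inj_eq perm_inj) iv /=.
by rewrite adj9K glue9K permK.
Qed.

Lemma corners_connected x y : connect (corner_adj adj9 glue9) x y.
Proof.
pose o : corner := (inord 0, inord 0).
have oE : corner_code o = (0, 0)%N by rewrite /corner_code /= !inordK.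
(* A Hamiltonian path in the graph of the 36 corners, starting from [o]. *)
pose w := [:: 1; 1; 0; 0; 1; 1; 0; 1; 1; 1; 0; 0; 1; 1; 0; 0; 0; 3; 0; 1; 0; 0;
  0; 0; 1; 1; 1; 1; 1; 1; 1; 0; 0; 0; 1]%N.
have from_o z : connect (corner_adj adj9 glue9) o z.
  have : corner_code z \in corner_code o :: corner_walk (corner_code o) w.
    case: z => t i; rewrite oE.
    by apply: (@forall_corner [in (0, 0)%N :: corner_walk (0, 0)%N w]); vm_compute.
  by rewrite inE => /orP[/eqP/corner_code_inj <-|/corner_walk_connect].
by apply: connect_trans (from_o y); rewrite (sym_connect_sym corner_adj_sym).
Qed.

(** The walk in the link crosses faces of tetrahedra. *)
Lemma tetrahedra_connected s t :
  connect (fun x y => [exists i, adj9 x i == y]) s t.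
Proof.
have /connectP[p pth tE] := corners_connected (s, ord0) (t, ord0).
suff walk x : path (corner_adj adj9 glue9) x p ->
    connect (fun x y => [exists i, adj9 x i == y]) x.1 (last x p).1.
  by have := walk _ pth; rewrite -tE.
elim: p x {pth tE} => [|y p IH] x //=.
case/andP=> /existsP[i /andP[_ /eqP ->]] /IH; apply: connect_trans.
by apply/connect1/existsP; exists i.
Qed.

(** * The link of the ideal vertex is a torus *)

Definition cross (x : nat * nat * nat) (i : nat) : nat * nat * nat :=
  (tet_across x.1.1 i, vertex_across x.1.1 i x.1.2, vertex_across x.1.1 i x.2).

Definition cross9 (x : flag) (i : 'I_4) : flag :=
  (adj9 x.1.1 i, glue9 x.1.1 i x.1.2, glue9 x.1.1 i x.2).

Lemma code_cross (x : flag) i : code (cross9 x i) = cross (code x) i.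
Proof. by rewrite /code /= adj9E !glue9E. Qed.

(** In a flag [(t, v, w)], a bottom face of [t] that contains the edge from [v]
  to [w], if this edge is not the top diagonal: bottom faces are opposite to the
  vertices 0 and 1, which are the ends of the top diagonal. *)
Definition lower_face (x : nat * nat * nat) : nat :=
  if (x.1.2 == 0%N) || (x.2 == 0%N) then 1%N else 0%N.

(** Every edge is the top diagonal of exactly one tetrahedron, and going down
  through bottom faces around the edge leads there from any other tetrahedron.
  This selects a representative of each vertex of the link. *)
Definition descend_code (x : nat * nat * nat) : nat * nat * nat :=
  if (x.1.2 < 2)%N && (x.2 < 2)%N then x else cross x (lower_face x).

Definition descend (x : flag) : flag :=
  let i : 'I_4 := inord (lower_face (code x)) in
  if (x.1.2 < 2)%N && (x.2 < 2)%N then x else cross9 x i.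

Lemma code_descend x : code (descend x) = descend_code (code x).
Proof.
rewrite /descend /descend_code; case: ifP => // _.
by rewrite code_cross inordK // /lower_face; case: ifP.
Qed.

Lemma link_triangles9 x : link_triangles adj9 glue9 x = setT.
Proof. by apply/setP=> y; rewrite !inE corners_connected. Qed.

Definition is_flag (x : nat * nat * nat) : bool := x.2 != x.1.2.

Lemma link_flags9 x : link_flags adj9 glue9 x = [set y : flag | is_flag (code y)].
Proof. by apply/setP=> y; rewrite inE link_triangles9 !inE. Qed.

Definition side_across (x : nat * nat * nat) : nat * nat * nat :=
  (tet_across x.1.1 x.2, vertex_across x.1.1 x.2 x.1.2, face_across x.1.1 x.2).

Definition flag_across (x : flag) : flag :=
  (adj9 x.1.1 x.2, glue9 x.1.1 x.2 x.1.2, glue9 x.1.1 x.2 x.2).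

Lemma code_flag_across x : code (flag_across x) = side_across (code x).
Proof. by rewrite /code /= adj9E glue9_self glue9E. Qed.

Lemma side_adjE x y : side_adj adj9 glue9 x y = (y == flag_across x).
Proof. by case: x => [[t v] i]. Qed.

Lemma flag_acrossK : involutive flag_across.
Proof. by case=> [[t v] i]; rewrite /flag_across /= adj9K glue9K !permK. Qed.

Lemma side_adj_sym : symmetric (side_adj adj9 glue9).
Proof. by move=> x y; rewrite !side_adjE eq_sym (inv_eq flag_acrossK). Qed.

(** The representative of a side is its name as a bottom face, each triangle being
  the bottom face of one of the two tetrahedra that it separates. *)
Definition bottom_side (x : flag) : flag := if is_top x.2 then flag_across x else x.

Definition bottom_side_code (x : nat * nat * nat) :=
  if is_top x.2 then side_across x else x.

Lemma code_bottom_side x : code (bottom_side x) = bottom_side_code (code x).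
Proof. by rewrite /bottom_side fun_if code_flag_across. Qed.

Lemma nb_sides x : nb_classes (side_adj adj9 glue9) (link_flags adj9 glue9 x) = 54%N.
Proof.
rewrite link_flags9 (nb_classes_retract (r := bottom_side) side_adj_sym).
- transitivity #|[set y : flag | is_flag (code y) && ~~ is_top (code y).2]|.
    apply: eq_card => y; rewrite !inE; congr (_ && _).
    rewrite /bottom_side /=; case: ifP => y_top; last by rewrite eqxx.
    apply/eqP => /(congr1 (fun z => is_top (code z).2)).
    rewrite code_flag_across.
    have check : all (fun z => is_top (face_across z.1.1 z.2) == ~~ is_top z.2) codes.
      by vm_compute.
    by have /eqP := forall_flag check y; rewrite /= y_top => ->.
  by rewrite (card_flags (fun y => is_flag y && ~~ is_top y.2)); vm_compute.
- move=> y _; rewrite /bottom_side; case: ifP => // _.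
  by apply/connect1; rewrite side_adjE.
move=> y z yA; rewrite side_adjE => /eqP ->; rewrite !inE in yA *.
rewrite -(inj_eq code_inj) !code_bottom_side code_flag_across.
have check : all (fun y => is_flag y ==> is_flag (side_across y) &&
    (bottom_side_code (side_across y) == bottom_side_code y)) codes by vm_compute.
exact: implyP (forall_flag check y) yA.
Qed.

Lemma link_vertex_adjP (x y : flag) :
  reflect (exists i, [/\ i != x.1.2, i != x.2 & y = cross9 x i])
          (link_vertex_adj adj9 glue9 x y).
Proof.
case: x => [[t v] w]; apply: (iffP existsP) => -[i].
  by case/and3P=> iv iw /eqP; exists i.
by case=> iv iw ->; exists i; apply/and3P.
Qed.

Lemma link_vertex_adj_sym : symmetric (link_vertex_adj adj9 glue9).
Proof.
suff sub x y : link_vertex_adj adj9 glue9 x y -> link_vertex_adj adj9 glue9 y x.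
  by move=> x y; apply/idP/idP; apply: sub.
case: x => [[t v] w] /link_vertex_adjP[i [/= iv iw ->]]; apply/link_vertex_adjP.
exists (glue9 t i i); rewrite /= !(inj_eq perm_inj) iv iw.
by rewrite /cross9 /= adj9K glue9K !permK.
Qed.

Lemma descend_connect x :
  is_flag (code x) -> connect (link_vertex_adj adj9 glue9) x (descend x).
Proof.
move=> x_flag; rewrite /descend; case: ifP => // x_diag.
apply/connect1/link_vertex_adjP; exists (inord (lower_face (code x))).
have l4 : (lower_face (code x) < 4)%N by rewrite /lower_face; case: ifP.
have check : all (fun y => is_flag y && ~~ ((y.1.2 < 2)%N && (y.2 < 2)%N) ==>
    (lower_face y != y.1.2) && (lower_face y != y.2)) codes by vm_compute.
have := implyP (forall_flag check x); rewrite x_flag x_diag => /(_ isT)/andP[l1 l2].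
by split=> //; rewrite -val_eqE /= inordK.
Qed.

(** Nine steps down are enough around every edge. *)
Definition lowest_flag (x : flag) : flag := iter 9 descend x.

Lemma code_lowest_flag x : code (lowest_flag x) = iter 9 descend_code (code x).
Proof. by rewrite /lowest_flag /= !code_descend. Qed.

Lemma is_flag_cross (x : flag) i : is_flag (code (cross9 x i)) = is_flag (code x).
Proof. by rewrite /is_flag /= !val_eqE (inj_eq perm_inj). Qed.

Lemma nb_link_vertices x :
  nb_classes (link_vertex_adj adj9 glue9) (link_flags adj9 glue9 x) = 18%N.
Proof.
rewrite link_flags9 (nb_classes_retract (r := lowest_flag) link_vertex_adj_sym).
- transitivity #|[set y : flag | is_flag (code y) && (iter 9 descend_code (code y) == code y)]|.
    apply: eq_card => y; rewrite !inE; congr (_ && _).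
    by rewrite -(inj_eq code_inj) code_lowest_flag.
  by rewrite (card_flags (fun y => is_flag y && (iter 9 descend_code y == y))); vm_compute.
- move=> y; rewrite inE /lowest_flag => y_flag.
  have descend_flag z : is_flag (code z) -> is_flag (code (descend z)).
    by rewrite /descend; case: ifP => // _; rewrite is_flag_cross.
  suff walk k : is_flag (code (iter k descend y)) /\
      connect (link_vertex_adj adj9 glue9) y (iter k descend y) by have [] := walk 9%N.
  elim: k => [|k [k_flag yk]] //=; split; first exact: descend_flag.
  exact: connect_trans yk (descend_connect k_flag).
move=> y z yA /link_vertex_adjP[i [iv iw ->]].
rewrite !inE in yA *; rewrite is_flag_cross yA /=.
rewrite -(inj_eq code_inj) !code_lowest_flag code_cross.
have check : all (fun y => is_flag y ==> all (fun i => (i != y.1.2) && (i != y.2) ==>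
    (iter 9 descend_code (cross y i) == iter 9 descend_code y)) (iota 0 4)) codes.
  by vm_compute.
have /allP/(_ (i : nat)) := implyP (forall_flag check y) yA.
by rewrite mem_iota ltn_ord /= => /(_ isT)/implyP; apply; rewrite iv iw.
Qed.

Lemma toroidal9 x : link_euler_char adj9 glue9 x = 0.
Proof.
rewrite /link_euler_char nb_sides nb_link_vertices link_triangles9 cardsT.
by rewrite card_prod !card_ord.
Qed.

Lemma no_fold9 t i : (adj9 t i, glue9 t i i) != (t, i).
Proof.
rewrite -(inj_eq corner_code_inj) /corner_code /= adj9E glue9_self.
by apply: (@forall_corner (fun x =>
  (tet_across x.1 x.2, face_across x.1 x.2) != x)); vm_compute.
Qed.

Definition tri9 : triangulation 9 := Triangulation (isT : (0 < 9)%N) adj9K glue9K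
  no_fold9 glue9_odd tetrahedra_connected toroidal9.

(** * The veering structure *)

Definition turn_code (x : nat * nat * nat) : nat * nat * nat :=
  (tet_across x.1.1 x.2, face_across x.1.1 x.2, vertex_across x.1.1 x.2 x.1.2).

Lemma code_turn x : code (turn tri9 x) = turn_code (code x).
Proof. by case: x => [[t i] j]; rewrite /code /= adj9E glue9_self glue9E. Qed.

(** The length of the orbit: no edge has more than 10 embeddings into
  tetrahedra. *)
Definition degree (x : nat * nat * nat) : nat :=
  (index x (traject turn_code (turn_code x) 10)).+1.

Definition orbit_code (x : nat * nat * nat) := traject turn_code x (degree x).

Lemma map_orbit9 (x : flag) : x.1.2 != x.2 ->
  map code (orbit (turn tri9) x) = orbit_code (code x).
Proof.
move=> x_edge.
have check : all (fun y => (y.1.2 != y.2) ==>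
    (iter (degree y) turn_code y == y) && uniq (orbit_code y)) codes by vm_compute.
have /andP[/eqP yK y_uniq] := implyP (forall_flag check x) x_edge.
exact: map_orbit code_inj code_turn _ yK y_uniq.
Qed.

Definition top9 (t : 'I_9) (i : 'I_4) : bool := is_top i.

Lemma top9_glue t i : top9 (adj tri9 t i) (glue tri9 t i i) = ~~ top9 t i.
Proof.
rewrite /top9 [glue _ _ _]/(glue9 t i) glue9_self.
have check : all (fun x => is_top (face_across x.1 x.2) == ~~ is_top x.2) corner_codes.
  by vm_compute.
exact: elimT eqP (forall_corner check t i).
Qed.

Lemma enum_top9 b t :
  map val (enum [pred i | top9 t i == b]) = if b then [:: 2; 3]%N else [:: 0; 1]%N.
Proof.
rewrite [enum _]/(filter _ _) -enumT -(filter_map val (fun i => is_top i == b)) val_enum_ord.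
by case: b.
Qed.

Lemma top9_two t : #|[set i | top9 t i]| = 2%N.
Proof.
have := congr1 size (enum_top9 true t); rewrite size_map -cardE; apply: etrans.
by apply: eq_card => i; rewrite !inE eqb_id.
Qed.

Definition same_side (x : nat * nat * nat) : bool := is_top x.1.2 == is_top x.2.

Lemma top9_angle_sum t i j : i != j ->
  (\sum_(x <- orbit (turn tri9) (t, i, j)) (top9 x.1.1 x.1.2 == top9 x.1.1 x.2))%N = 2%N.
Proof.
move=> ij; rewrite -(big_map code xpredT (fun y => nat_of_bool (same_side y))).
rewrite map_orbit9 //; apply/eqP.
have check : all (fun y => (y.1.2 != y.2) ==>
    (sumn (map (fun z => nat_of_bool (same_side z)) (orbit_code y)) == 2%N)) codes.
  by vm_compute.
have := implyP (forall_flag check (t, i, j)) ij.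
by rewrite sumnE big_map.
Qed.

Definition taut9 : transverse_taut 9 := TransverseTaut top9_glue top9_two top9_angle_sum.

Definition red9 (x : flag) : bool := red_pair x.1.1 x.1.2 x.2.

Lemma red9_sym t i j : red9 (t, i, j) = red9 (t, j, i).
Proof. by rewrite /red9 /red_pair /= andbC orbC addnC. Qed.

Lemma red9_turn t i j : i != j -> red9 (turn taut9 (t, i, j)) = red9 (t, i, j).
Proof.
move=> ij; pose red_code y := red_pair y.1.1 y.1.2 y.2.
rewrite -[LHS]/(red_code (code (turn tri9 (t, i, j)))) code_turn.
have check : all (fun y => (y.1.2 != y.2) ==>
    (red_code (turn_code y) == red_code y)) codes by vm_compute.
exact: elimT eqP (implyP (forall_flag check (t, i, j)) ij).
Qed.

(** The hypotheses only leave the permutations that preserve both the pair 0, 1 of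
  bottom faces and the pair 2, 3 of top faces.  Composition with either of the
  two transpositions changes the parity of [p], and also the equatorial edge
  between faces [p 0] and [p 2] into one of opposite slope. *)
Lemma red9_equatorial t (p : 'S_4) :
  ~~ top taut9 t (p 0) -> ~~ top taut9 t (p 1) ->
  top taut9 t (p 2) -> top taut9 t (p 3) ->
  red9 (t, p 0, p 2) = ~~ odd_perm p.
Proof.
rewrite /= /top9 /is_top /red9 /red_pair /= /is_top => p0 p1 p2 p3.
rewrite p2 (negPf p0) /=.
have neq (i j : 'I_4) : i != j -> p i <> p j :> nat.
  by move=> ij /val_inj/perm_inj/eqP; apply/negP.
have pE (s : 'S_4) : p 0 = s 0 :> nat -> p 1 = s 1 :> nat -> p 2 = s 2 :> nat ->
    p 3 = s 3 :> nat -> p = s.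
  move=> e0 e1 e2 e3; apply/permP=> i; apply: val_inj.
  have : (i \in [:: 0; 1; 2; 3]) by case: i => [[|[|[|[|//]]]] ?].
  by rewrite !inE => /or4P[] /eqP ->.
have p4 i : (p i < 4)%N := ltn_ord (p i).
have n01 := neq 0 1 isT; have n23 := neq 2 3 isT.
move: p0 p1 p2 p3 (p4 2) (p4 3) n01 n23.
case E0: (p 0 : nat) => [|[|//]] _; case E1: (p 1 : nat) => [|[|//]] _;
case E2: (p 2 : nat) => [|[|[|[|//]]]] // _; case E3: (p 3 : nat) => [|[|[|[|//]]]] // _ _ _ //= _ _.
- by rewrite (pE 1%g) ?perm1 ?odd_perm1.
- by rewrite (pE (tperm 2 3)) ?odd_tperm // val_tperm.
- by rewrite (pE (tperm 0 1)) ?odd_tperm // val_tperm.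
- by rewrite (pE (tperm 0%R 1%R * tperm 2%R 3%R)%g) ?odd_permM ?odd_tperm // permM !val_tperm.
Qed.

Definition veering9 : veering 9 := Veering red9_sym red9_turn red9_equatorial.

(** * The augmented veering polynomials of the example *)

Definition diagonal_code (x : nat * nat * nat) : bool := is_top x.1.2 && is_top x.2.

Definition below_code (x : nat * nat * nat) : nat :=
  (iter (find diagonal_code (orbit_code x)) turn_code x).1.1.

Lemma edge_below9 (x : flag) :
  x.1.2 != x.2 -> edge_below veering9 x = below_code (code x) :> nat.
Proof.
move=> x_edge; rewrite /edge_below /below_code -map_orbit9 // find_map.
rewrite -[LHS]/((code _).1.1).
suff -> k : code (iter k (turn tri9) x) = iter k turn_code (code x) by [].
by elim: k => //= k <-; rewrite code_turn.
Qed.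

Lemma code_diagonal b t :
  code (diagonal veering9 b t) = if b then (t : nat, 2, 3)%N else (t : nat, 0, 1)%N.
Proof.
have nthE k : (k < 2)%N -> nth 0 (enum [pred i | top9 t i == b]) k =
    nth 0%N (if b then [:: 2; 3]%N else [:: 0; 1]%N) k :> nat.
  move=> k2; rewrite -(enum_top9 b t) (nth_map 0) //.
  by rewrite -(size_map val) enum_top9; case: b.
by rewrite /code /= !nthE //; case: (b).
Qed.

Definition equatorial_code (t i0 j0 s : nat) : nat :=
  sumn [seq sumn [seq nat_of_bool (s == below_code (t, i, j)) | j <- iota 0 4
                 & ~~ is_top j && (red_pair t i j != red_pair t i0 j0)]
       | i <- iota 0 4 & is_top i].

Lemma sumn_ord n (P : pred nat) (F : nat -> nat) :
  sumn [seq F i | i <- iota 0 n & P i] = (\sum_(i < n | P i) F i)%N.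
Proof. by rewrite sumnE big_map big_filter -(big_mkord P F) /index_iota subn0. Qed.

Lemma nb_equatorial9 (t s : 'I_9) (d : flag) (i0 j0 : nat) :
  code d = (t : nat, i0, j0) ->
  nb_equatorial veering9 t d s = equatorial_code t i0 j0 s.
Proof.
move=> dE; rewrite /equatorial_code sumn_ord; apply: eq_bigr => i i_top.
rewrite sumn_ord; apply: eq_big => [j|j /andP[j_bot _]].
  by have -> : red veering9 d = red_pair t i0 j0 by case: dE => <- <- <-.
rewrite -val_eqE /= edge_below9 //=.
by apply: contraTneq i_top => ->.
Qed.

Definition lower_code (t s : nat) : int :=
  (s == below_code (t, 2, 3)%N)%:Z - (s == below_code (t, 0, 1)%N)%:Z
  - (equatorial_code t 0 1 s)%:Z.

Definition upper_code (t s : nat) : int :=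
  (s == below_code (t, 0, 1)%N)%:Z - (s == below_code (t, 2, 3)%N)%:Z
  - (equatorial_code t 2 3 s)%:Z.

Lemma diagonal_below9 b (t s : 'I_9) :
  (s == edge_below veering9 (diagonal veering9 b t)) =
  (s == below_code (if b then (t : nat, 2, 3)%N else (t : nat, 0, 1)%N) :> nat).
Proof.
rewrite -val_eqE /= edge_below9 ?code_diagonal //.
rewrite -val_eqE -[_ == _]/((code _).1.2 == (code _).2) code_diagonal.
by case: b.
Qed.

Lemma augmentation_NL9 (D : fundamental_domain veering9) (t s : 'I_9) :
  augmentation (NL D t 0 s) = (lower_code t s)%:~R.
Proof.
rewrite augmentation_NL (diagonal_below9 true) (diagonal_below9 false).
by rewrite (nb_equatorial9 _ (code_diagonal false t)) !rmorphB.
Qed.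

Lemma augmentation_NU9 (D : fundamental_domain veering9) (t s : 'I_9) :
  augmentation (NU D t 0 s) = (upper_code t s)%:~R.
Proof.
rewrite augmentation_NU (diagonal_below9 true) (diagonal_below9 false).
by rewrite (nb_equatorial9 _ (code_diagonal true t)) !rmorphB.
Qed.

Lemma sum_ord9 (R : pzRingType) (F : 'I_9 -> R) :
  \sum_i F i = F 0 + F 1 + F 2 + F 3 + F 4 + F 5 + F 6 + F 7 + F 8.
Proof.
rewrite !big_ord_recr big_ord0 /= add0r.
by do !congr (_ + _); congr F; apply: val_inj.
Qed.

(** Singular because rows 0 and 8 have the same sum as rows 2 and 6. *)
Lemma upper_augmentation (D : fundamental_domain veering9) :
  augmentation (upper_veering_polynomial D) = 0.
Proof.
rewrite augmentation_det; apply/eqP/det0P.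
pose v (t : nat) : int := nth 0 [:: 1; 0; -1; 0; 0; 0; -1; 0; 1] t.
exists (\row_t (v t)%:~R).
  by apply/eqP => /rowP/(_ 0); rewrite !mxE.
apply/rowP=> s; rewrite !mxE.
transitivity ((\sum_(t < 9) v t * upper_code t s)%:~R : rat).
  rewrite rmorph_sum; apply: eq_bigr => t _; rewrite mxE mxE augmentation_NU9.
  by rewrite rmorphM.
suff -> : \sum_(t < 9) v t * upper_code t s = 0 by [].
rewrite sum_ord9; apply/eqP.
have check : all (fun s => v 0 * upper_code 0 s + v 1 * upper_code 1 s
  + v 2 * upper_code 2 s + v 3 * upper_code 3 s + v 4 * upper_code 4 s
  + v 5 * upper_code 5 s + v 6 * upper_code 6 s + v 7 * upper_code 7 s
  + v 8 * upper_code 8 s == 0) (iota 0 9) by vm_compute.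
by have /allP/(_ (s : nat)) := check; rewrite mem_iota ltn_ord; apply.
Qed.

(** Let [v] be a row vector in the left kernel of the augmented matrix.  Column 3
  gives [v0 = 0], then columns 4, 2, 7 give [v4 = v1], [v8 = - v1], [v7 = 0].
  Columns 5 and 6 give [v5 - v6 = v1] and [v6 - v5 = v2], so [v2 = - v1];
  columns 1 and 8 give [v3 = 2 v1] and [v5 = - 3 v1], hence [v6 = - 4 v1], and
  column 0 becomes [10 v1 = 0]. *)
Lemma lower_augmentation (D : fundamental_domain veering9) :
  augmentation (lower_veering_polynomial D) != 0.
Proof.
rewrite augmentation_det; apply/det0P => -[v /negP v0 vN]; apply: v0.
have eqn (s : 'I_9) : \sum_t v 0 t * (lower_code t s)%:~R = 0.
  have /rowP/(_ s) := vN; rewrite !mxE => vNs; rewrite -[RHS]vNs.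
  by apply: eq_bigr => t _; rewrite mxE augmentation_NL9.
have eqnE (s : 'I_9) : v 0 0 * (lower_code 0 s)%:~R + v 0 1 * (lower_code 1 s)%:~R
  + v 0 2 * (lower_code 2 s)%:~R + v 0 3 * (lower_code 3 s)%:~R
  + v 0 4 * (lower_code 4 s)%:~R + v 0 5 * (lower_code 5 s)%:~R
  + v 0 6 * (lower_code 6 s)%:~R + v 0 7 * (lower_code 7 s)%:~R
  + v 0 8 * (lower_code 8 s)%:~R = 0 by rewrite -[RHS](eqn s) sum_ord9.
have [e0 e1 e2 e3 e4] := And5 (eqnE 0) (eqnE 1) (eqnE 2) (eqnE 3) (eqnE 4).
have [e5 e6 e7 e8] := And4 (eqnE 5) (eqnE 6) (eqnE 7) (eqnE 8).
vm_compute lower_code in e0, e1, e2, e3, e4, e5, e6, e7, e8.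
(* All other entries are multiples of [v 0 1]. *)
have v1 : v 0 1 = 0 by lra.
have [v0 v2 v3 v4] : [/\ v 0 0 = 0, v 0 2 = 0, v 0 3 = 0 & v 0 4 = 0] by split; lra.
have [v5 v6 v7 v8] : [/\ v 0 5 = 0, v 0 6 = 0, v 0 7 = 0 & v 0 8 = 0] by split; lra.
have /allP v_all : all (fun i => v 0 i == 0) [:: 0; 1; 2; 3; 4; 5; 6; 7; 8].
  by rewrite /= v0 v1 v2 v3 v4 v5 v6 v7 v8 eqxx.
apply/eqP/rowP=> i; rewrite mxE; apply/eqP/v_all.
by case: i; do 9?case=> //.
Qed.

Theorem proposition6p7 :
  exists (n : nat) (V : veering n) (D : fundamental_domain V),
    ~ eq_up_to_unit (lower_veering_polynomial D) (upper_veering_polynomial D).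
Proof.
have [D] := exists_fundamental_domain veering9.
exists 9%N, veering9, D => /eq_up_to_unit_augmentation.
by move=> /(_ (upper_augmentation D))/eqP; apply/negP/lower_augmentation.
Qed.
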